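(* Let $a\ge b\ge c\ge 1$ be integers with $b\ge 2$, and let $n=a+b+c-1$. Then \[X_{\theta_{abc}}=\sum_{I\vDash n}c_I\,w_I\,e_I,\qquad c_I=\sum_{k=2}^{c}\Theta_I^+(k)-\sum_{k=a}^{a+c-2}\Theta^-_{\overline I}(k)+\Delta_I(b+c-1),\] where the sum runs over all compositions $I$ of $n$ (empty sums are $0$).
   Context: $X_G$ denotes the chromatic symmetric function $\sum_\kappa\prod_{v}x_{\kappa(v)}$ over proper colorings $\kappa\colon V(G)\to\{1,2,\dots\}$. The theta graph $\theta_{abc}$ consists of two distinct vertices joined by three internally disjoint paths of lengths (numbers of edges) $a,b,c$; it has $a+b+c-1$ vertices. A composition $I=i_1i_2\cdots i_z\vDash n$ is a sequence of positive integers with sum $|I|=n$; $\ell(I)=z$; $\overline I=i_z\cdots i_1$ is its reversal; $|i_1\cdots i_k|=i_1+\dots+i_k$. Set $e_I=e_{i_1}\cdots e_{i_z}$ (product of elementary symmetric functions) and $w_I=i_1(i_2-1)(i_3-1)\cdots(i_z-1)$. For real $x$: $\sigma_I^+(x)=\min\{|i_1\cdots i_k|:0\le k\le z,\ |i_1\cdots i_k|\ge x\}$, $\Theta_I^+(x)=\sigma_I^+(x)-x$; $\sigma_I^-(x)=\max\{|i_1\cdots i_k|:0\le k\le z,\ |i_1\cdots i_k|\le x\}$, $\Theta_I^-(x)=x-\sigma_I^-(x)$. Let $e_2(x_1,\dots,x_m)=\sum_{1\le i<j\le m}x_ix_j$. For an integer $m$ with $1\le m\le n-1$, define $p,s,q,t$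 by $m=i_1+\dots+i_{p-1}+s=i_2+\dots+i_q+t$ with $1\le p,q\le z$, $1\le s\le i_p$, $1\le t\le i_{q+1}$, using the convention $i_{z+1}=i_1$; then $\Delta_I(m)=s(i_p-s-i_1)$ if $i_1\le i_p-s$, and $\Delta_I(m)=e_2(i_p-s,i_{p+1},\dots,i_q,t)$ otherwise. *)

(* Defs.v *)
From HB Require Import structures.
From mathcomp Require Import all_boot all_order all_algebra.
From mathcomp Require Import finmap multiset.
From mathcomp Require Import boolp classical_sets functions.
From mathcomp Require Import cardinality fsbigop.

Set Implicit Arguments.
Unset Strict Implicit.
Unset Printing Implicit Defensive.

Import Order.TTheory GRing.Theory Num.Theory.
Local Open Scope ring_scope.

(** * Formal power series in countably many commuting variables

    A monomial is the multiset of its variables, so that the product of two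
    monomials is [msetD] and divisibility is [msubset].  The variables
    x_1, x_2, ... are indexed from 0.  A power series is the family of its
    coefficients. *)

Definition monomial := {mset nat}%mset.

Definition mdivisors (m : monomial) : seq monomial :=
  undup [seq seq_mset (mask (val b) (enum_mset m))
        | b : (size (enum_mset m)).-tuple bool].

Lemma mem_mdivisors (m a : monomial) : (a \in mdivisors m) = (a `<=` m)%mset.
Proof.
rewrite mem_undup; apply/mapP/idP => [[b _ ->]|le_am].
  apply/msubsetP => x; rewrite mset_seqE -count_mem_mset.
  exact/leq_count_subseq/mask_subseq.
have /count_subseqP[s /subseqP[b sz_b ->] perm_s] :
    forall x, (count_mem x (enum_mset a) <= count_mem x (enum_mset m))%N.
  by move=> x; rewrite !count_mem_mset; exact: (msubsetP le_am).
have tb : size b == size (enum_mset m) by rewrite sz_b.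
exists (Tuple tb); first by rewrite mem_enum.
by rewrite -[LHS]seq_mset_id; apply/eq_seq_msetP.
Qed.

Lemma mdivisors_uniq (m : monomial) : uniq (mdivisors m).
Proof. exact: undup_uniq. Qed.

Record mseries (R : Type) := MSeries { mcoef :> monomial -> R }.

HB.instance Definition _ (R : Type) := [isNew for @mcoef R].
HB.instance Definition _ (R : choiceType) := [Choice of mseries R by <:].

Section MSeriesRing.
Variable R : comNzRingType.
Implicit Types f g h : mseries R.
Implicit Types m a b c : monomial.

Lemma mseriesP f g : (forall m, f m = g m) <-> f = g.
Proof.
split=> [eq_fg|->//]; case: f g eq_fg => f [g] /= eq_fg.
by congr MSeries; apply/funext.
Qed.

Definition ms_zero := MSeries (fun=> 0 : R).
Definition ms_opp f := MSeries (fun m => - f m).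
Definition ms_add f g := MSeries (fun m => f m + g m).

Fact ms_addA : associative ms_add.
Proof. by move=> f g h; apply/mseriesP => m /=; rewrite addrA. Qed.
Fact ms_addC : commutative ms_add.
Proof. by move=> f g; apply/mseriesP => m /=; rewrite addrC. Qed.
Fact ms_add0 : left_id ms_zero ms_add.
Proof. by move=> f; apply/mseriesP => m /=; rewrite add0r. Qed.
Fact ms_addN : left_inverse ms_zero ms_opp ms_add.
Proof. by move=> f; apply/mseriesP => m /=; rewrite addNr. Qed.

HB.instance Definition _ :=
  GRing.isZmodule.Build (mseries R) ms_addA ms_addC ms_add0 ms_addN.

Definition ms_one := MSeries (fun m => (m == mset0)%:R : R).
Definition ms_mul f g :=
  MSeries (fun m => \sum_(a <- mdivisors m) f a * g (m `\` a)%mset).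

Fact ms_mulC : commutative ms_mul.
Proof.
move=> f g; apply/mseriesP => m /=.
have perm_m : perm_eq (mdivisors m) [seq (m `\` a)%mset | a <- mdivisors m].
  apply: uniq_perm; first exact: mdivisors_uniq.
    rewrite map_inj_in_uniq ?mdivisors_uniq// => a b.
    rewrite !mem_mdivisors => le_am le_bm eq_ab.
    by rewrite -(msetBBK le_am) eq_ab msetBBK.
  move=> a; apply/idP/mapP => [|[b _ ->]]; rewrite mem_mdivisors.
    move=> le_am; exists (m `\` a)%mset; last by rewrite msetBBK.
    by rewrite mem_mdivisors msubsetDl.
  exact: msubsetDl.
rewrite (perm_big _ perm_m) big_map; apply: eq_big_seq => a.
by rewrite mem_mdivisors => le_am; rewrite msetBBK// mulrC.
Qed.

Fact ms_mulA : associative ms_mul.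
Proof.
move=> f g h; apply/mseriesP => m /=.
under [RHS]eq_bigr do rewrite big_distrl /=.
transitivity (\sum_(a <- mdivisors m) \sum_(b <- mdivisors m | (b `<=` a)%mset)
    f b * g (a `\` b)%mset * h (m `\` a)%mset); last first.
  apply: eq_big_seq => a; rewrite mem_mdivisors => le_am.
  rewrite -[LHS]big_filter; apply: perm_big; apply: uniq_perm.
  - exact/filter_uniq/mdivisors_uniq.
  - exact: mdivisors_uniq.
  move=> b; rewrite mem_filter !mem_mdivisors; case: (boolP (b `<=` a)%mset) => //.
  by move=> le_ba; rewrite (msubset_trans le_ba le_am).
rewrite (exchange_big_dep predT) //=.
apply: eq_big_seq => b; rewrite mem_mdivisors => le_bm.
rewrite big_distrr /= -[RHS]big_filter.
have perm_b : perm_eq [seq a <- mdivisors m | (b `<=` a)%mset]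
    [seq (b `+` c)%mset | c <- mdivisors (m `\` b)%mset].
  apply: uniq_perm; first exact/filter_uniq/mdivisors_uniq.
    rewrite map_inj_uniq ?mdivisors_uniq//; exact: can_inj (msetDKB b).
  move=> a; rewrite mem_filter mem_mdivisors; apply/andP/mapP => [[le_ba le_am]|].
    exists (a `\` b)%mset; last by rewrite msetBDKC.
    by rewrite mem_mdivisors msetSB.
  move=> [c]; rewrite mem_mdivisors => /(msetDS b); rewrite msetBDKC// => le_cm ->.
  by split=> //; apply/msubsetP => x; rewrite msetE2 leq_addr.
rewrite (perm_big _ perm_b) big_map; apply: eq_bigr => c _.
by rewrite msetDKB msetBDA mulrA.
Qed.

Fact ms_mul1 : left_id ms_one ms_mul.
Proof.
move=> f; apply/mseriesP => m /=.
rewrite (bigD1_seq mset0) ?mdivisors_uniq//=; last by rewrite mem_mdivisors msub0set.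
by rewrite eqxx mul1r msetB0 big1 ?addr0// => a /negPf->; rewrite mul0r.
Qed.

Fact ms_mulDl : left_distributive ms_mul ms_add.
Proof.
move=> f g h; apply/mseriesP => m /=; rewrite -big_split.
by apply: eq_bigr => a _; rewrite mulrDl.
Qed.

Fact ms_one_neq0 : ms_one != 0.
Proof.
apply/eqP => /mseriesP/(_ mset0) /=; rewrite eqxx; exact/eqP/oner_neq0.
Qed.

HB.instance Definition _ := GRing.Zmodule_isComNzRing.Build (mseries R)
  ms_mulA ms_mulC ms_mul1 ms_mulDl ms_one_neq0.

Definition ms_var (i : nat) : mseries R :=
  MSeries (fun m => (m == [mset i]%mset)%:R).

(* Sum of a possibly infinite family, taken coefficientwise; it is meaningful
   when every monomial occurs in only finitely many members of the family. *)
Definition ms_sum (T : choiceType) (A : set T) (F : T -> mseries R) :=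
  MSeries (fun m => \sum_(t \in A) F t m).

(* e_k: the sum of the products of k distinct variables *)
Definition elem_sym (k : nat) : mseries R :=
  ms_sum [set S : {fset nat} | #|` S| = k] (fun S => \prod_(i <- S) ms_var i).

Definition chromatic_sym (V : finType) (e : rel V) : mseries R :=
  ms_sum [set kappa : {ffun V -> nat} | forall x y, e x y -> kappa x <> kappa y]
    (fun kappa => \prod_v ms_var (kappa v)).

End MSeriesRing.

(** * Theta graphs *)

Section Theta.
Variables a b c : nat.

Definition theta_len (k : 'I_3) : nat := nth 0%N [:: a; b; c] k.

(* [inl false] and [inl true] are the two vertices joined by the three paths;
   [inr (Tagged _ j)] with tag k is the internal vertex at distance j+1 from
   [inl false] along the k-th path. *)
Definition theta_vertex : finType :=
  (bool + {k : 'I_3 & 'I_(theta_len k).-1})%type.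

(* the vertex at distance j from [inl false] along the k-th path, j <= theta_len k *)
Definition theta_pos (k : 'I_3) (j : nat) : theta_vertex :=
  if j is j'.+1 then
    if (insub j' : option 'I_(theta_len k).-1) is Some i
    then inr (Tagged (fun k : 'I_3 => 'I_(theta_len k).-1) i)
    else inl true
  else inl false.

Definition theta_edge : rel theta_vertex := fun x y =>
  [exists k : 'I_3, exists j : 'I_(theta_len k),
    ((x == theta_pos k j) && (y == theta_pos k j.+1)) ||
    ((y == theta_pos k j) && (x == theta_pos k j.+1))].

Lemma theta_edge_sym : symmetric theta_edge.
Proof.
by move=> x y; rewrite /theta_edge; apply: eq_existsb => k;
   apply: eq_existsb => j; rewrite orbC.
Qed.

Lemma theta_edge_irr : irreflexive theta_edge.
Proof.
move=> x; apply/existsP => -[k /existsP[j]]; rewrite orbb => /andP[/eqP->].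
case: j => [[|j] lt_jk] /=; first by case: insubP.
case: insubP => [u _ <-|]; last by rewrite -ltnS (ltn_predK lt_jk) lt_jk.
case: insubP => //= v _ vE /eqP[] /eqP; rewrite eq_Tagged /= => /eqP uv.
by move: vE; rewrite -uv => /eqP; rewrite ltn_eqF.
Qed.

Lemma card_theta_vertex : (0 < a)%N -> (0 < b)%N -> (0 < c)%N ->
  #|theta_vertex| = (a + b + c - 1)%N.
Proof.
move=> a0 b0 c0; rewrite card_sum card_bool card_tagged sumnE big_map big_enum /=.
rewrite !big_ord_recl big_ord0 /= !card_ord /theta_len /=.
case: (a) a0 (b) b0 (c) c0 => // a' _ [|b'] // _ [|c'] // _ /=.
by rewrite subn1 !(addnS, addSn) /= add0n addn0 !addnA.
Qed.

End Theta.

(** * Compositions *)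

Definition composition (n : nat) (I : seq nat) : Prop :=
  all (leq 1) I /\ sumn I = n.

Definition e_comp (R : comNzRingType) (I : seq nat) : mseries R :=
  \prod_(i <- I) elem_sym R i.

Definition w_comp (I : seq nat) : nat :=
  (head 0 I * \prod_(i <- behead I) (i - 1))%N.

Section Theta_functions.
Variable R : realDomainType.

(* The minimum is over a nonempty set when x <= |I|; the largest partial sum
   |I| is then a neutral element for it. *)
Definition sigma_plus (I : seq nat) (x : R) : nat :=
  \big[minn/sumn I]_(k < (size I).+1 | x <= (sumn (take k I))%:R) sumn (take k I).

Definition Theta_plus (I : seq nat) (x : R) : R := (sigma_plus I x)%:R - x.

Definition sigma_minus (I : seq nat) (x : R) : nat :=
  \max_(k < (size I).+1 | (sumn (take k I))%:R <= x) sumn (take k I).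

Definition Theta_minus (I : seq nat) (x : R) : R := x - (sigma_minus I x)%:R.

End Theta_functions.

Definition e2 (s : seq nat) : nat :=
  (\sum_(j < size s) \sum_(i < j) nth 0 s i * nth 0 s j)%N.

(* For 1 <= m <= |I|, [locate I m] is the pair (p, s) such that
   m = i_1 + ... + i_{p-1} + s, 1 <= p <= l(I) and 1 <= s <= i_p. *)
Fixpoint locate (I : seq nat) (m : nat) : nat * nat :=
  if I is i :: I' then
    if (m <= i)%N then (1%N, m) else let: (p, s) := locate I' (m - i) in (p.+1, s)
  else (0%N, m).

Lemma locateP (I : seq nat) (m p s : nat) :
  all (leq 1) I -> (1 <= m <= sumn I)%N ->
  locate I m = (p, s) <->
  [/\ (1 <= p <= size I)%N, m = (sumn (take p.-1 I) + s)%N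
    & (1 <= s <= nth 0 I p.-1)%N].
Proof.
elim: I m p s => [|i I IH] m p s /=; first by case: m.
move=> /andP[i0 I0] /andP[m0 le_m].
case: (leqP m i) => [le_mi|lt_im].
  split=> [[? ?]|[/andP[]]]; first by subst; rewrite m0 le_mi.
  case: p => // -[|p] //= _ _; first by rewrite add0n => ->.
  move=> mE /andP[s0 _]; move: le_mi; rewrite mE -addnA -[leqRHS]addn0 leq_add2l.
  by rewrite leqn0 addn_eq0 (gtn_eqF s0) andbF.
have mi : (1 <= m - i <= sumn I)%N by rewrite subn_gt0 lt_im leq_subLR.
case locE: (locate I (m - i)) => [p' s'].
split=> [[? ?]|[/andP[]]].
  subst; have [/andP[p'0 p'I] miE s'P] := (IH _ _ _ I0 mi).1 locE.
  case: p' p'0 p'I {locE} miE s'P => //= p' _ p'I miE s'P.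
  by split=> //; rewrite -addnA -miE subnKC // ltnW.
case: p => // -[|p] //= _ pI.
  by rewrite add0n => <- /andP[_]; rewrite leqNgt lt_im.
move=> mE sP; suff : locate I (m - i) = (p.+1, s) by rewrite locE => -[-> ->].
by apply/(IH _ _ _ I0 mi); split=> //=; rewrite mE -addnA addKn.
Qed.

(* [rot 1 I] lists i_2, ..., i_z, i_{z+1} = i_1. *)
Definition Delta (I : seq nat) (m : nat) : nat :=
  let: (p, s) := locate I m in
  let: (q, t) := locate (rot 1 I) m in
  let i1 := head 0%N I in
  let ip := nth 0%N I p.-1 in
  if (i1 <= ip - s)%N then (s * (ip - s - i1))%N
  else e2 ((ip - s)%N :: drop p (take q I) ++ [:: t]).

Definition c_comp (a b c : nat) (I : seq nat) : int :=
  \sum_(2 <= k < c.+1) Theta_plus I k%:R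
  - \sum_(a <= k < (a + c - 1)%N) Theta_minus (rev I) k%:R
  + (Delta I (b + c - 1))%:R.

(** * The sums [ms_sum] and [\sum_(I \in _)] above have finite support *)

Local Open Scope classical_set_scope.

Lemma ms_varM (R : comNzRingType) i (g : mseries R) (m : monomial) :
  (ms_var R i * g) m = if i \in m then g (m `\ i)%mset else 0.
Proof.
change ((ms_var R i * g) m) with (\sum_(a <- mdivisors m) ms_var R i a * g (m `\` a)%mset).
case: ifPn => im; last first.
  rewrite big_seq big1 // => a; rewrite mem_mdivisors /= => am.
  case: eqP => [aE|]; last by rewrite mul0r.
  by move: am; rewrite aE msub1set (negPf im).
rewrite (bigD1_seq [mset i]%mset) ?mdivisors_uniq ?mem_mdivisors ?msub1set //=.
by rewrite eqxx mul1r big1 ?addr0 // => a /negPf->; rewrite mul0r.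
Qed.

Lemma prod_ms_var (R : comNzRingType) (s : seq nat) (m : monomial) :
  (\prod_(i <- s) ms_var R i) m = (m == seq_mset s)%:R.
Proof.
elim: s m => [|i s IH] m.
  rewrite big_nil; change ((m == mset0)%:R = (m == seq_mset [::])%:R :> R).
  congr ((m == _)%:R); by apply/msetP => x; rewrite mset_seqE mset0E.
rewrite big_cons ms_varM IH; have -> : seq_mset (i :: s) = (i +` seq_mset s)%mset.
  by apply/msetP => x; rewrite mset1DE !mset_seqE /= eq_sym.
case: ifPn => im.
  have -> : ((m `\ i)%mset == seq_mset s) = (m == (i +` seq_mset s)%mset) => //.
  by apply/eqP/eqP => [<-|->]; rewrite ?msetB1K ?msetD1K.
by case: eqP => // mE; move: im; rewrite mE in_mset1D eqxx.
Qed.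

Lemma elem_symE (R : comNzRingType) k (m : monomial) :
  elem_sym R k m = ((size (enum_mset m) == k) && uniq (enum_mset m))%:R.
Proof.
rewrite /elem_sym /ms_sum /=.
under eq_fsbigr do rewrite prod_ms_var.
have key (S : {fset nat}) : m = seq_mset S <-> perm_eq (enum_mset m) S.
  split=> [->|]; first exact: perm_eq_seq_mset.
  by move=> /eq_seq_msetP; rewrite seq_mset_id.
have fin : forall S : {fset nat}, [set S | #|` S| = k] S ->
   S <> [fset x in enum_mset m]%fset -> (m == seq_mset S)%:R = 0 :> R.
  move=> S _ NS; case: eqP => // /key pS; case: NS.
  by apply/fsetP => x; rewrite !inE /= (perm_mem pS).
case: (boolP (_ && _)) => [/andP[/eqP sz u]|N].
  have pm : perm_eq (enum_mset m) [fset x in enum_mset m]%fset.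
    by apply: uniq_perm => // x; rewrite inE.
  rewrite -(@fsbig_widen _ _ _ _ [set [fset x in enum_mset m]%fset]).
  - by rewrite fsbig_set1; have /key <- := pm; rewrite eqxx.
  - by move=> S /= ->; rewrite -sz (perm_size pm).
  - move=> S [/= Sk NS]; exact: (fin S Sk NS).
rewrite fsbig1 // => S /= Sk; case: eqP => // /key pS.
by move: N; rewrite (perm_size pS) Sk eqxx (perm_uniq pS) fset_uniq.
Qed.

Lemma finite_composition n : finite_set [set I | composition n I].
Proof.
pose T := {k : 'I_n.+1 & k.-tuple 'I_n.+1}.
apply: (@sub_finite_set _ _ [set [seq val i | i <- tagged u] | u in [set: T]]).
  move=> I /= [I1 IE].
  have sz : (size I < n.+1)%N.
    rewrite ltnS -IE; elim: I I1 {IE} => //= i I IH /andP[i1 /IH]; rewrite -add1n; exact: leq_add.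
  have bd : all (fun i => i < n.+1)%N I.
    apply/allP => i /rot_to[j s E]; rewrite ltnS -IE.
    have -> : sumn I = sumn (rot j I) by rewrite !sumnE; apply: perm_big; rewrite perm_sym perm_rot.
    by rewrite E /= leq_addr.
  exists (Tagged (fun k : 'I_n.+1 => k.-tuple 'I_n.+1) (i := Ordinal sz)
    (map_tuple (inord : nat -> 'I_n.+1) (in_tuple I))) => //=.
  rewrite -map_comp -[RHS]map_id; apply/eq_in_map => i /(allP bd) /= ?.
  by rewrite inordK.
exact/finite_image/finite_finset.
Qed.

Lemma finite_coloring (R : comNzRingType) (V : finType) (m : monomial) :
  finite_set [set k : {ffun V -> nat} | (\prod_v ms_var R (k v)) m <> 0].
Proof.
have E (k : {ffun V -> nat}) : (\prod_v ms_var R (k v)) m = (m == seq_mset [seq k v | v : V])%:R.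
  by rewrite -prod_ms_var big_map big_enum.
pose B := (\max_(i <- enum_mset m) i).+1.
apply: (@sub_finite_set _ _ [set [ffun v => val (f v)] | f in [set: {ffun V -> 'I_B}]]).
  move=> k /=; rewrite E; case: eqP => // mE _.
  exists [ffun v => inord (k v)] => //; apply/ffunP => v; rewrite !ffunE inordK // ltnS.
  apply: (@leq_bigmax_seq _ _ xpredT id) => //.
  by rewrite mE (perm_mem (perm_eq_seq_mset _)); apply/mapP; exists v; rewrite ?mem_enum.
exact/finite_image/finite_finset.
Qed.

(* Main.v *)
Require Import Defs.
From mathcomp Require Import all_boot all_order all_algebra.
From mathcomp Require Import ring zify.
From mathcomp Require Import finmap multiset.
From mathcomp Require Import boolp classical_sets functions cardinality fsbigop.

Set Implicit Arguments.
Unset Strict Implicit.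
Unset Printing Implicit Defensive.

Import Order.TTheory GRing.Theory Num.Theory.
Local Open Scope ring_scope.

(* Write T(m; l) for the cycle of length m with a pendant path of l further
   vertices.  Triple deletion at a branch vertex gives
     theta(a, b, c) = theta(a, b-1, c+1) + T(a+c; b-1) - T(a+b-1; c)
   and T(m; l) = T(m+1; l-1) + C_m P_l - P_(m+l).  Together with
   P_n = sum_I w_I e_I, the second relation gives by induction
   T(m; l) = sum_I Theta^+_I(l+1) w_I e_I.  Iterating the first one with a fixed
   expresses theta(a, b, c) through the cycle-chord theta(a, b+c-1, 1) and
   tadpoles; iterating it again with the chord fixed expresses the cycle-chord
   through the cycle theta(1, n-1, 1) and tadpoles.  The resulting coefficient of
   a cycle-chord is a difference of two sums of Theta^+.  Reversing i_2 ... i_z,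
   which preserves w_I e_I, in the second sum turns the difference into Delta_I.

   The identities are proved for colourings in a finite set of colours, weighted
   by elements of a commutative ring; a coefficient of X_G only involves the
   colours occurring in its monomial. *)

(** * Walks, tadpoles and theta graphs as weighted sums; triple deletion *)

Section WeightedWalks.
Variables (R : comNzRingType) (K : finType) (x : K -> R).
Implicit Types (u v p q : K) (a b c l m n : nat).

Definition neqr u v : R := (u != v)%:R.

Lemma neqrC u v : neqr u v = neqr v u.
Proof. by rewrite /neqr eq_sym. Qed.

(* Triple deletion for the triangle [u], [p], [q]. *)
Lemma neqr_triangle u p q :
  neqr u p * neqr u q = neqr p q * neqr u q + neqr u p - neqr p q.
Proof.
rewrite /neqr; case: (eqVneq u p) => [<-|nup] /=.
  by case: (u != q) => /=; ring.
by case: (eqVneq u q) => [<-|_] /=; rewrite 1?[p == u]eq_sym ?nup /=; ring.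
Qed.

(* [walk_ker n p v] weighs all vertices but the last of the proper walks of
   length [n] from [p] to [v], and [walk n u v] the inner vertices of the
   proper walks of length [n.+1] from [u] to [v]. *)
Fixpoint walk_ker n p v : R :=
  if n is n'.+1 then x p * \sum_q neqr p q * walk_ker n' q v else (p == v)%:R.

Definition walk n u v : R := \sum_q neqr u q * walk_ker n q v.

(** A pendant path at [v]: proper walks of [l] steps out of [v], with [v] itself not weighed. *)
Fixpoint tail l v : R :=
  if l is l'.+1 then \sum_q neqr v q * (x q * tail l' q) else 1.

Arguments tail : simpl never.

Lemma tail_rec l v : tail l.+1 v = \sum_q neqr v q * (x q * tail l q).
Proof. by []. Qed.

Definition path_sym n : R := if n is n'.+1 then \sum_v x v * tail n' v else 1.
Arguments path_sym : simpl never.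

(* The cycle has [m.+1] vertices and the pendant path [l] further ones. *)
Definition tadpole m l : R := \sum_v x v * walk m v v * tail l v.

(* The three paths have lengths [a.+1], [b.+1] and [c.+1]. *)
Definition theta a b c : R :=
  \sum_u \sum_v x u * x v * walk a u v * walk b u v * walk c u v.

Lemma walk0 u v : walk 0 u v = neqr u v.
Proof.
rewrite /walk (bigD1 v) //= eqxx mulr1 big1 ?addr0 // => q /negPf->.
by rewrite mulr0.
Qed.

Lemma walkS n u v : walk n.+1 u v = \sum_q neqr u q * (x q * walk n q v).
Proof. by []. Qed.

Lemma walk_cat a b u v :
  \sum_w walk a u w * (x w * walk b w v) = walk (a + b).+1 u v.
Proof.
elim: a u => [|a IH] u.
  by rewrite walkS; apply: eq_bigr => w _; rewrite walk0.
rewrite walkS; under eq_bigr do rewrite walkS mulr_suml.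
rewrite exchange_big; apply: eq_bigr => q _ /=.
by rewrite -IH !mulr_sumr; apply: eq_bigr => w _; ring.
Qed.

Lemma walkC n u v : walk n u v = walk n v u.
Proof.
elim: n u v => [|n IH] u v; first by rewrite !walk0 neqrC.
rewrite walkS -[n in RHS]addn0 -walk_cat; apply: eq_bigr => q _.
by rewrite walk0 IH neqrC; ring.
Qed.

Lemma sum_walk n v : \sum_q x q * walk n v q = tail n.+1 v.
Proof.
elim: n v => [|n IH] v.
  by apply: eq_bigr => q _; rewrite walk0 mulr1 mulrC.
under eq_bigr do rewrite walkS mulr_sumr.
rewrite tail_rec exchange_big; apply: eq_bigr => p _ /=.
by rewrite -IH !mulr_sumr; apply: eq_bigr => q _; ring.
Qed.

Lemma tail_cat l m : \sum_q x q * tail l q * tail m q = path_sym (l + m).+1.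
Proof.
elim: m l => [|m IH] l.
  by rewrite addn0; apply: eq_bigr => q _; rewrite mulr1.
rewrite -addSnnS -IH.
under eq_bigr do rewrite tail_rec mulr_sumr.
rewrite exchange_big; apply: eq_bigr => p _ /=.
by rewrite tail_rec mulr_sumr mulr_suml; apply: eq_bigr => q _; rewrite neqrC; ring.
Qed.

(** The next colour is arbitrary except for that of [v]: take the whole path sum and remove the term
    at [v]. *)
Lemma tailS l v : tail l.+1 v = path_sym l.+1 - x v * tail l v.
Proof.
rewrite tail_rec /path_sym [in RHS](bigD1 v) //= [RHS]addrC addKr [LHS](bigD1 v) //=.
rewrite /neqr eqxx mul0r add0r; apply: eq_bigr => q nqv.
by rewrite eq_sym nqv mul1r.
Qed.

(** A cycle of length 2 is a doubled edge, and [neqr] is idempotent. *)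
Lemma tadpole1 l : tadpole 1 l = path_sym l.+2.
Proof.
rewrite -(tail_cat 1); apply: eq_bigr => v _; congr (_ * _ * _).
rewrite -sum_walk walkS; apply: eq_bigr => q _.
rewrite !walk0 [neqr q v]neqrC /neqr; case: (v != q) => /=; ring.
Qed.

(** Triple deletion at the vertex [v] carrying the tail, with [p] its neighbour on the cycle and [q]
    the first tail vertex. Replacing the edge [vp] by [qp] inserts [q] into the cycle; dropping [vq]
    splits off the tail; keeping only [pq] opens the cycle to a path. *)
Lemma tadpole_step m l :
  tadpole m l.+1 =
  tadpole m.+1 l + tadpole m 0 * path_sym l.+1 - path_sym (m + l).+2.
Proof.
have -> : tadpole m l.+1 = \sum_v \sum_p \sum_q
    (neqr v p * neqr v q) * (x v * walk_ker m p v * (x q * tail l q)).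
  apply: eq_bigr => v _; rewrite /walk tail_rec [x v * _]mulr_sumr mulr_suml.
  apply: eq_bigr => p _; rewrite mulr_sumr; apply: eq_bigr => q _; ring.
have -> : tadpole m 0 * path_sym l.+1 = \sum_v \sum_p \sum_q
    neqr v p * (x v * walk_ker m p v * (x q * tail l q)).
  rewrite mulr_suml; apply: eq_bigr => v _.
  rewrite /walk mulr1 [x v * _]mulr_sumr mulr_suml.
  apply: eq_bigr => p _; rewrite mulr_sumr; apply: eq_bigr => q _; ring.
have -> : tadpole m.+1 l = \sum_v \sum_p \sum_q
    (neqr p q * neqr v q) * (x v * walk_ker m p v * (x q * tail l q)).
  rewrite /tadpole.
  under [RHS]eq_bigr do rewrite exchange_big /=.
  rewrite [RHS]exchange_big; apply: eq_bigr => q _ /=.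
  rewrite walkS mulr_sumr mulr_suml; apply: eq_bigr => v _.
  rewrite walkC /walk !mulr_sumr mulr_suml; apply: eq_bigr => p _.
  by rewrite [neqr q v]neqrC [neqr q p]neqrC; ring.
have -> : path_sym (m + l).+2 = \sum_v \sum_p \sum_q
    neqr p q * (x v * walk_ker m p v * (x q * tail l q)).
  rewrite -addSn addnC -tail_cat.
  under [RHS]eq_bigr do rewrite exchange_big /=.
  rewrite [RHS]exchange_big; apply: eq_bigr => q _ /=.
  rewrite -sum_walk mulr_sumr; apply: eq_bigr => v _.
  rewrite /walk !mulr_sumr; apply: eq_bigr => p _.
  by rewrite [neqr q p]neqrC; ring.
rewrite -big_split -sumrB; apply: eq_bigr => v _ /=.
rewrite -big_split -sumrB; apply: eq_bigr => p _ /=.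
rewrite -big_split -sumrB; apply: eq_bigr => q _ /=.
by rewrite neqr_triangle; ring.
Qed.

(** Triple deletion at the branch vertex [u], with [p] and [q] its neighbours on the first two
    paths. Replacing [up] by [qp] makes [q] the branch vertex and prolongs the third path by [uq].
    Dropping [uq] leaves the second path pendant at [v]; keeping only [pq] leaves the third one,
    ending in [u]. *)
Lemma theta_step a b c :
  theta a b.+1 c =
  theta a b c.+1 + tadpole (a + c).+1 b.+1 - tadpole (a + b).+1 c.+1.
Proof.
pose F u v p q :=
  x u * x v * x q * walk_ker a p v * walk b q v * walk c u v.
have -> : theta a b.+1 c = \sum_u \sum_v \sum_p \sum_q
    (neqr u p * neqr u q) * F u v p q.
  apply: eq_bigr => u _; apply: eq_bigr => v _.
  rewrite walkS [walk a u v]/walk [_ * x v * _]mulr_sumr !mulr_suml.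
  apply: eq_bigr => p _; rewrite mulr_sumr mulr_suml.
  by apply: eq_bigr => q _; rewrite /F; ring.
have -> : theta a b c.+1 = \sum_u \sum_v \sum_p \sum_q
    (neqr p q * neqr u q) * F u v p q.
  rewrite /theta exchange_big [RHS]exchange_big; apply: eq_bigr => v _ /=.
  under [RHS]eq_bigr do rewrite exchange_big /=.
  rewrite [RHS]exchange_big; apply: eq_bigr => q _ /=.
  rewrite walkS mulr_sumr; apply: eq_bigr => u _.
  rewrite [walk a q v]/walk [_ * x v * _]mulr_sumr !mulr_suml.
  by apply: eq_bigr => p _; rewrite /F [neqr q p]neqrC [neqr q u]neqrC; ring.
have -> : tadpole (a + c).+1 b.+1 = \sum_u \sum_v \sum_p \sum_q
    neqr u p * F u v p q.
  rewrite /tadpole [RHS]exchange_big; apply: eq_bigr => v _ /=.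
  rewrite -walk_cat -sum_walk [x v * _]mulr_sumr mulr_suml.
  apply: eq_bigr => u _; rewrite walkC [walk a u v]/walk mulr_suml.
  rewrite [x v * _]mulr_sumr mulr_suml; apply: eq_bigr => p _; rewrite mulr_sumr.
  by apply: eq_bigr => q _; rewrite /F [walk b v q]walkC; ring.
have -> : tadpole (a + b).+1 c.+1 = \sum_u \sum_v \sum_p \sum_q
    neqr p q * F u v p q.
  rewrite /tadpole [RHS]exchange_big; apply: eq_bigr => v _ /=.
  rewrite -walk_cat -sum_walk mulr_sumr.
  apply: eq_bigr => u _; rewrite [x v * _]mulr_sumr mulr_suml [RHS]exchange_big.
  apply: eq_bigr => q _ /=; rewrite [walk a v q]walkC [walk a q v]/walk.
  rewrite mulr_suml [x v * _]mulr_sumr mulr_suml; apply: eq_bigr => p _.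
  by rewrite /F [neqr q p]neqrC [walk c v u]walkC; ring.
rewrite -big_split -sumrB; apply: eq_bigr => u _ /=.
rewrite -big_split -sumrB; apply: eq_bigr => v _ /=.
rewrite -big_split -sumrB; apply: eq_bigr => p _ /=.
rewrite -big_split -sumrB; apply: eq_bigr => q _ /=.
by rewrite neqr_triangle; ring.
Qed.

Lemma theta_rot a b c : theta a b c = theta c a b.
Proof. by apply: eq_bigr => u _; apply: eq_bigr => v _; ring. Qed.

Lemma theta0n0 b : theta 0 b 0 = tadpole b.+1 0.
Proof.
apply: eq_bigr => u _; rewrite walkS mulr1 mulr_sumr; apply: eq_bigr => v _.
by rewrite !walk0 [walk b v u]walkC /neqr; case: (u != v) => /=; ring.
Qed.

End WeightedWalks.

Arguments tail : simpl never.
Arguments path_sym : simpl never.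

(** * Sums over compositions *)

Definition comps n : {fset seq nat} := fset_set [set I | composition n I].

Lemma mem_comps n I : (I \in comps n) = all (leq 1) I && (sumn I == n).
Proof.
rewrite in_fset_set; last exact: finite_composition.
by apply/idP/andP; rewrite in_setE => -[? /eqP].
Qed.

Section CompositionSums.
Variables (R : nmodType) (F : seq nat -> R).

Lemma big_comps0 : \sum_(I <- comps 0) F I = F [::].
Proof.
rewrite (perm_big [:: [::]]) ?big_seq1 //; apply: uniq_perm => [||I] //.
  exact: fset_uniq.
rewrite mem_comps inE; case: I => //= -[|i] I; by rewrite // addSn andbF.
Qed.

Lemma big_comps_rcons n :
  \sum_(I <- comps n.+1) F I =
  \sum_(i < n.+1) \sum_(J <- comps (n - i)) F (rcons J i.+1).
Proof.
rewrite (partition_big (fun I => inord (last 0 I).-1 : 'I_n.+1) predT) //.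
apply: eq_bigr => i _; rewrite -big_filter -(big_map (rcons^~ i.+1) predT F).
apply: perm_big; apply: uniq_perm.
- exact/filter_uniq/fset_uniq.
- by rewrite map_inj_uniq ?fset_uniq // => J J' /rcons_inj[].
move=> I; rewrite mem_filter mem_comps; apply/andP/mapP => [[]|[J]].
  case/lastP: I => [|J y]; first by rewrite andbF.
  rewrite last_rcons all_rcons sumn_rcons -val_eqE /= => /eqP iE.
  move=> /andP[/andP[y0 J0] /eqP Sy].
  have yE : y = i.+1 by move: iE; rewrite inordK; lia.
  exists J; last by rewrite yE.
  by rewrite mem_comps J0 /=; apply/eqP; move: (ltn_ord i); lia.
rewrite mem_comps => /andP[J0 /eqP SJ] ->.
rewrite last_rcons all_rcons sumn_rcons J0 -val_eqE /= inordK ?ltn_ord // eqxx.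
by split=> //; apply/eqP; move: (ltn_ord i); lia.
Qed.

End CompositionSums.

(* [next_gap I k] is Theta^+_I(k) for 1 <= k <= |I|, and [prev_gap I k] is
   Theta^-_I(k) for 0 <= k < |I|. *)
Fixpoint next_gap (I : seq nat) (k : nat) : nat :=
  if I is i :: I' then if (k <= i)%N then (i - k)%N else next_gap I' (k - i)
  else 0%N.

Fixpoint prev_gap (I : seq nat) (k : nat) : nat :=
  if I is i :: I' then if (k < i)%N then k else prev_gap I' (k - i) else k.

(** * Gaps to the neighbouring partial sums *)

Section NextGap.
Implicit Types (I J K : seq nat) (i k l : nat).
Local Open Scope nat_scope.

Lemma next_gap_cat0 K J : K != [::] -> next_gap (K ++ J) (sumn K) = 0.
Proof.
elim: K => //= i K IH _; case: leqP => [?|lt_i]; first by lia.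
by rewrite addKn IH //; apply: contraL lt_i => /eqP-> /=; lia.
Qed.

Lemma next_gap_catS K J : next_gap (K ++ J) (sumn K).+1 = next_gap J 1.
Proof.
by elim: K => //= i K IH; rewrite ltnNge leq_addr /= -addnS addKn.
Qed.

Lemma next_gap_split I l : 0 < l <= sumn I -> next_gap I l = 0 ->
  exists K J, I = K ++ J /\ sumn K = l.
Proof.
elim: I l => /= [|i I IH] l; first by lia.
move=> ll; case: (leqP l i) => [le_li|lt_il]; first by
  move=> ?; exists [:: i], I; split=> //=; lia.
have lI : 0 < l - i <= sumn I by lia.
move=> /(IH _ lI)[K [J [-> SK]]].
by exists (i :: K), J; split=> //=; lia.
Qed.

(** The gap drops by one from [l] to [l.+1] unless [l] is a partial sum; there it is 0 and the
    conditional term makes up the difference. That term is the contribution of cycle times path in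
    [tadpole_step]. *)
Lemma next_gapS I l : 0 < l < sumn I ->
  next_gap I l + (if next_gap I l == 0 then (next_gap I l.+1).+1 else 0) =
  (next_gap I l.+1).+1.
Proof.
elim: I l => /= [|i I IH] l; first by lia.
move=> ll; case: (ltngtP l i) => [lt_li|lt_il|->].
- by case: eqP; lia.
- by rewrite subSn ?(ltnW lt_il) // IH; lia.
- by rewrite subnn eqxx.
Qed.

Lemma next_gap_rcons J y k : 0 < k ->
  next_gap (rcons J y) k = if k <= sumn J then next_gap J k else sumn J + y - k.
Proof.
elim: J k => [|i J IH] k k0 /=.
  by rewrite leqn0 eqn0Ngt k0 /=; case: leqP; lia.
case: leqP => [le_ki|lt_ik]; first by rewrite ifT; lia.
rewrite IH; last by lia.
by rewrite leq_subLR; case: (leqP k (i + sumn J)) => // ?; lia.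
Qed.

(** Reversal turns partial sums at most [k] into partial sums at least [sumn L - k]. *)
Lemma prev_gapE L k : k < sumn L -> prev_gap L k = next_gap (rev L) (sumn L - k).
Proof.
elim: L k => //= i L IH k lt_k.
rewrite rev_cons next_gap_rcons ?subn_gt0 // sumn_rev.
case: (ltnP k i) => [lt_ki|le_ik]; first by rewrite ifF; lia.
rewrite IH ?ifT; last 2 first; [by lia | by lia |].
by congr next_gap; lia.
Qed.

Lemma w_comp_cat K J : K != [::] ->
  w_comp (K ++ J) = w_comp K * \prod_(i <- J) (i - 1).
Proof. by case: K => //= i K _; rewrite /w_comp /= big_cat mulnA. Qed.

Lemma w_comp_rcons J i : J != [::] -> w_comp (rcons J i.+1) = w_comp J * i.
Proof. by move=> nJ; rewrite -cats1 w_comp_cat // big_seq1 subn1. Qed.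

End NextGap.

(** * Paths and tadpoles in elementary symmetric functions *)

Section PathsAndTadpoles.
Variables (R : comNzRingType) (K : finType) (x : K -> R).
Implicit Types (v : K) (k l m n : nat) (I J : seq nat).

Definition esp k : R := \sum_(S : {set K} | #|S| == k) \prod_(i in S) x i.

Definition esp_wo v k : R :=
  \sum_(S : {set K} | (#|S| == k) && (v \notin S)) \prod_(i in S) x i.

Lemma esp_with v k :
  \sum_(S : {set K} | (#|S| == k.+1) && (v \in S)) \prod_(i in S) x i =
  x v * esp_wo v k.
Proof.
rewrite /esp_wo mulr_sumr.
rewrite (reindex_onto (fun S => v |: S)%SET (fun S => S :\ v)%SET) /=; last first.
  by move=> S /andP[_ /finset.setD1K].
apply: eq_big => S.
  rewrite in_setU1 eqxx andbT cardsU1 /=.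
  case: (boolP (v \in S)) => vS /=.
    rewrite andbF; apply/negP => /andP[_ /eqP SE].
    by move: vS; rewrite -SE !inE eqxx.
  by rewrite add1n eqSS andbT setU1K ?eqxx ?andbT.
rewrite in_setU1 eqxx andbT => /andP[_ /eqP SE].
have vS : v \notin S by rewrite -SE !inE eqxx.
by rewrite big_setU1.
Qed.

Lemma espS v k : esp k.+1 = esp_wo v k.+1 + x v * esp_wo v k.
Proof. by rewrite -esp_with /esp (bigID (fun S : {set K} => v \in S)) addrC. Qed.

Lemma esp0 v : esp 0 = esp_wo v 0.
Proof.
apply: eq_bigl => S; case: eqP => //= /eqP; rewrite cards_eq0 => /eqP->.
by rewrite inE.
Qed.

(** Double counting: a set of size [k.+1] arises once for each of its elements. *)
Lemma sum_esp_wo k : \sum_v x v * esp_wo v k = k.+1%:R * esp k.+1.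
Proof.
under eq_bigr do rewrite -esp_with big_mkcondr.
rewrite exchange_big mulr_sumr; apply: eq_bigr => S /eqP cS.
by rewrite -big_mkcond /= sumr_const cS mulr_natl.
Qed.

(* Both sides are the coefficient of z^n in E(z) P(z) / (1 + x_v z), where E and P
   are the generating functions of [esp] and [path_sym]. *)
Lemma esp_wo_path v n :
  \sum_(i < n.+1) esp_wo v i * path_sym x (n - i) =
  \sum_(i < n.+1) esp i * tail x (n - i) v.
Proof.
have pathE k : path_sym x k.+1 = tail x k.+1 v + x v * tail x k v.
  by rewrite tailS addrNK.
rewrite big_ord_recr big_ord_recl /= subnn subn0 (esp0 v).
under eq_bigr => i _ do rewrite -(subnSK (ltn_ord i)) pathE mulrDr.
under [X in _ = _ + X]eq_bigr => i _ do
  rewrite /= /bump /= add1n (espS v) mulrDl.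
rewrite !big_split /= addrAC addrA; congr (_ + _); last first.
  by apply: eq_bigr => i _; ring.
transitivity (\sum_(i < n.+1) esp_wo v i * tail x (n - i) v).
  rewrite big_ord_recr /= subnn; congr (_ + _).
  by apply: eq_bigr => i _; rewrite -(subnSK (ltn_ord i)).
by rewrite big_ord_recl /= subn0.
Qed.

(** Multiply [esp_wo_path] by [x v] and sum over [v]. On the left [sum_esp_wo] yields the factor
    [i.+1], on the right the path grows by one vertex; cancelling the common products leaves [i]. *)
Lemma path_rec n :
  path_sym x n.+1 = n.+1%:R * esp n.+1 +
    \sum_(i < n) i%:R * esp i.+1 * path_sym x (n - i).
Proof.
have : \sum_(i < n.+1) i.+1%:R * esp i.+1 * path_sym x (n - i) =
       \sum_(i < n.+1) esp i * path_sym x (n - i).+1.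
  transitivity (\sum_v x v * \sum_(i < n.+1) esp_wo v i * path_sym x (n - i)).
    under [RHS]eq_bigr do rewrite mulr_sumr.
    rewrite [RHS]exchange_big; apply: eq_bigr => i _ /=.
    by rewrite -sum_esp_wo mulr_suml; apply: eq_bigr => v _; rewrite mulrA.
  under eq_bigr do rewrite esp_wo_path mulr_sumr.
  rewrite exchange_big; apply: eq_bigr => i _ /=.
  by rewrite mulr_sumr; apply: eq_bigr => v _; ring.
rewrite big_ord_recr /= subnn mulr1 big_ord_recl /= subn0.
have -> : esp 0 = 1.
  rewrite /esp (big_pred1 (finset.set0 : {set K})) ?finset.big_set0 // => S.
  by rewrite cards_eq0.
rewrite mul1r; set S := \sum_(i < n) esp _ * _ => H.
apply: (@addIr _ S); rewrite -H [LHS]addrC -[RHS]addrA; congr (_ + _).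
rewrite -big_split; apply: eq_bigr => i _ /=.
by rewrite /bump /= add1n subnSK // -natr1; ring.
Qed.

Definition esp_comp I : R := \prod_(i <- I) esp i.

Definition comp_sum n (f : seq nat -> nat) : R :=
  \sum_(I <- comps n) (f I * w_comp I)%:R * esp_comp I.


(** [path_rec] peels off the last part: [i.+1] after other parts has factor [i], a sole part its
    full size, as in [w_comp]. *)
Lemma path_comp_sum n : path_sym x n.+1 = comp_sum n.+1 (fun=> 1%N).
Proof.
elim/ltn_ind: n => n IH; rewrite path_rec /comp_sum big_comps_rcons.
rewrite big_ord_recr /= subnn big_comps0 addrC; congr (_ + _).
  by rewrite /= /esp_comp big_seq1 /w_comp /= big_nil muln1 mul1n.
apply: eq_bigr => i _; have lt_in := ltn_ord i.
rewrite -(subnSK lt_in) IH; last by lia.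
rewrite mulr_sumr big_seq [RHS]big_seq; apply: eq_bigr => J.
rewrite mem_comps => /andP[_ /eqP SJ]; have nJ : J != [::].
  by apply: contra_eqN SJ => /eqP->.
by rewrite w_comp_rcons // /esp_comp big_rcons /= !mul1n natrM; ring.
Qed.

Lemma big_comps_cat (F : seq nat -> R) l m : (0 < l)%N ->
  \sum_(I <- comps (l + m) | next_gap I l == 0%N) F I =
  \sum_(I <- comps l) \sum_(J <- comps m) F (I ++ J).
Proof.
move=> l0; rewrite -big_filter.
rewrite -(big_allpairs_dep (h := fun I J => I ++ J) (r2 := fun=> comps m)).
apply: perm_big; apply: uniq_perm.
- exact/filter_uniq/fset_uniq.
- apply: allpairs_uniq; rewrite ?fset_uniq //.
  move=> [I J] [I' J'] /allpairsP[[a b] /= [aC _ [-> ->]]].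
  move=> /allpairsP[[a' b'] /= [aC' _ [-> ->]]] {I J I' J'} eq_ab.
  move: aC aC'; rewrite !mem_comps => /andP[a0 /eqP Sa] /andP[a'0 /eqP Sa'].
  (* Parts are positive, so two prefixes of one list with equal sums coincide. *)
  suff aE : a = a'.
    by move: eq_ab; rewrite aE => /eqP; rewrite eqseq_cat // eqxx => /eqP->.
  elim: a a' {l0} l a0 a'0 Sa Sa' eq_ab => [|i a IH] [|i' a'] l //=.
  + by move=> _ /andP[]; lia.
  + by move=> /andP[]; lia.
  move=> /andP[_ a0] /andP[_ a'0] Sa Sa' [ii' eq_ab].
  by rewrite ii' (IH a' (l - i)%N) //; lia.
move=> I; rewrite mem_filter mem_comps; apply/andP/allpairsP => [[/eqP gI]|].
  move=> /andP[I0 /eqP SI].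
  have [||a [b [IE Sa]]] := @next_gap_split I l; rewrite ?SI ?l0 ?leq_addr //.
  exists (a, b); move: I0 SI; rewrite !mem_comps IE all_cat sumn_cat /= Sa eqxx.
  by move=> /andP[-> ->] /= Sb; split=> //; apply/eqP; lia.
move=> [[a b] /= []]; rewrite !mem_comps => /andP[a0 /eqP Sa] /andP[b0 /eqP Sb] ->.
rewrite all_cat sumn_cat a0 b0 Sa Sb eqxx -Sa next_gap_cat0 //.
by apply: contraTneq l0 => aE; rewrite -Sa aE.
Qed.

(** [tadpole_step] is solved for the tadpole with the longer cycle. The outer induction, on [m + l],
    supplies the bare cycle; the inner one, on [m], supplies the tadpole with the shorter cycle and
    longer tail. *)
Lemma tadpole_comp_sum m l :
  tadpole x m.+1 l = comp_sum (m + l).+2 (next_gap^~ l.+1).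
Proof.
have [n] := ubnP (m + l); elim: n m l => // n IHn; elim=> [|m IHm] l lt_n.
  (* As [I] sums to [l.+2], the gap is 1 unless the last part is 1, and then [w_comp I] is 0. *)
  rewrite tadpole1 path_comp_sum; apply: eq_big_seq => I.
  rewrite mem_comps => /andP[I0 /eqP SI]; congr (_%:R * _).
  case/lastP: I I0 SI => [|J [|[|y]]] //; rewrite all_rcons sumn_rcons //= => J0 SJ.
    rewrite w_comp_rcons ?muln0 //.
    by apply: contra_eqN SJ => /eqP->.
  by rewrite next_gap_rcons // ifF; lia.
have := tadpole_step x m.+1 l; rewrite IHm; last by lia.
rewrite (IHn m 0%N); last by lia.
rewrite !path_comp_sum addn0 => H.
have {H}-> : tadpole x m.+2 l = comp_sum (m + l.+1).+2 (next_gap^~ l.+2) -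
    comp_sum m.+2 (next_gap^~ 1%N) * comp_sum l.+1 (fun=> 1%N) +
    comp_sum (m.+1 + l).+2 (fun=> 1%N) by rewrite H; ring.
(* Concatenate with the composition of the path in front. If [J] starts with [j], its gap at 1 is
   [j - 1]; the product [(j - 1) * j] is now read as the gap plus one, times the weight [j - 1] of a
   non-initial part. *)
have -> : comp_sum m.+2 (next_gap^~ 1%N) * comp_sum l.+1 (fun=> 1%N) =
    comp_sum (m.+1 + l).+2
      (fun I => if next_gap I l.+1 == 0%N then (next_gap I l.+2).+1 else 0%N).
  transitivity (\sum_(I <- comps (l.+1 + m.+2) | next_gap I l.+1 == 0%N)
      ((next_gap I l.+2).+1 * w_comp I)%:R * esp_comp I); last first.
    rewrite big_mkcond /comp_sum; have -> : (l.+1 + m.+2 = (m.+1 + l).+2)%N by lia.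
    by apply: eq_bigr => I _; case: ifP => //; rewrite mul0n mul0r.
  rewrite big_comps_cat // mulrC mulr_suml; apply: eq_big_seq => I.
  rewrite mem_comps => /andP[_ /eqP SI]; rewrite mulr_sumr.
  apply: eq_big_seq => -[|j J]; rewrite mem_comps // => /andP[/andP[j0 _] _].
  have nI : I != [::] by apply: contra_eqN SI => /eqP->.
  rewrite -SI next_gap_catS w_comp_cat // big_cons /= j0 /esp_comp big_cat /=.
  rewrite /w_comp /= mul1n -!/(w_comp _).
  case: j j0 => // j _; rewrite subn1 /= !natrM; ring.
rewrite addnS addSn /comp_sum -sumrB -big_split; apply: eq_big_seq => I /=.
rewrite mem_comps => /andP[_ /eqP SI].
rewrite -mulrBl -mulrDl; congr (_ * _).
have lI : (0 < l.+1 < sumn I)%N by lia.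
have := next_gapS lI; set d := (if _ then _ else _) => E.
have {E} : (next_gap I l.+1 + d)%:R = (next_gap I l.+2).+1%:R :> R by rewrite E.
rewrite natrD -natr1 !natrM => /eqP; rewrite -subr_eq => /eqP <-; ring.
Qed.

End PathsAndTadpoles.

(** * From gap sums to [Delta] *)

Section DeltaGaps.
Implicit Types (I J : seq nat) (i k l m n p q s t : nat).
Local Open Scope nat_scope.

Lemma bin2D m n : 'C(m + n, 2) = 'C(m, 2) + 'C(n, 2) + m * n.
Proof.
elim: m => [|m IH]; first by rewrite mul0n addn0.
by rewrite addSn !binS !bin1 IH mulSn; lia.
Qed.

Lemma e2_cons i I : e2 (i :: I) = i * sumn I + e2 I.
Proof.
rewrite /e2 /= big_ord_recl big_ord0 add0n.
under [LHS]eq_bigr => j _ do rewrite lift0 big_ord_recl /=.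
rewrite big_split -big_distrr /=; congr (_ * _ + _).
by rewrite sumnE (big_nth 0) big_mkord.
Qed.

(** [e2] is the defect of additivity of ['C(_, 2)]; this is how it enters [Delta]. *)
Lemma bin2_sumn I : 'C(sumn I, 2) = \sum_(i <- I) 'C(i, 2) + e2 I.
Proof.
elim: I => [|i I IH] /=; first by rewrite big_nil /e2 big_ord0.
by rewrite bin2D IH big_cons e2_cons; lia.
Qed.

(** Across a full part [i] the gaps are [i - 1, ..., 0], with sum ['C(i, 2)]. The last part is
    crossed only up to [s]; the binomial on the left restores its remaining gaps. *)
Lemma sum_next_gap I m p s : 0 < m <= sumn I -> locate I m = (p, s) ->
  \sum_(0 <= j < m) next_gap I j.+1 + 'C(nth 0 I p.-1 - s, 2) =
  \sum_(i <- take p I) 'C(i, 2).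
Proof.
have block i k : k <= i -> \sum_(0 <= j < k) (i - j.+1) + 'C(i - k, 2) = 'C(i, 2).
  elim: k => [|k IH] le_ki; first by rewrite big_nil subn0.
  rewrite big_nat_recr //= -IH; last by lia.
  by rewrite -(subnSK le_ki) binS bin1; lia.
elim: I m p s => [|i I IH] m p s /=; first by lia.
move=> mI; case: leqP => [le_mi [<- <-]|lt_im].
  rewrite /= take0 big_seq1 -(block i m le_mi); congr (_ + _).
  by apply: eq_big_nat => j /andP[_ jm]; rewrite ifT //; lia.
case locE: (locate I (m - i)) => [p' s'] [<- <-].
have mI' : 0 < m - i <= sumn I by lia.
have p'0 : 0 < p'.
  case: I {IH mI} locE mI' => [|i' I] /=; first by lia.
  by case: ifP => _; [|case: locate => ? ?] => -[<-].
rewrite (big_cat_nat (n := i)) //=; last by lia.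
rewrite -[X in \sum_(X <= _ < m) _](add0n i) big_addn -addnA big_cons.
have -> : nth 0 (i :: I) p' = nth 0 I p'.-1 by rewrite -{1}(prednK p'0).
rewrite -(IH _ _ _ mI' locE); congr (_ + (_ + _)).
  rewrite -[RHS](block i i) // subnn addn0.
  by apply: eq_big_nat => j /andP[_ jm]; rewrite ifT //; lia.
apply: eq_bigr => j _; rewrite ifF; last by lia.
by congr next_gap; lia.
Qed.

(** Here the gaps in a part increase from 0, so the incomplete last part contributes its [s]
    smallest ones. *)
Lemma sum_prev_gap I m p s : 0 < m <= sumn I -> locate I m = (p, s) ->
  \sum_(0 <= j < m) prev_gap I j =
  \sum_(i <- take p.-1 I) 'C(i, 2) + 'C(s, 2).
Proof.
elim: I m p s => [|i I IH] m p s /=; first by lia.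
move=> mI; case: leqP => [le_mi [<- <-]|lt_im].
  rewrite big_nil add0n -bin2_sum.
  by apply: eq_big_nat => j /andP[_ jm]; rewrite ifT //; lia.
case locE: (locate I (m - i)) => [p' s'] [<- <-].
have mI' : 0 < m - i <= sumn I by lia.
have p'0 : 0 < p'.
  case: I {IH mI} locE mI' => [|i' I] /=; first by lia.
  by case: ifP => _; [|case: locate => ? ?] => -[<-].
rewrite (big_cat_nat (n := i)) //=; last by lia.
rewrite -[X in \sum_(X <= _ < m) _](add0n i) big_addn.
rewrite -{1}(prednK p'0) /= big_cons -addnA -(IH _ _ _ mI' locE); congr (_ + _).
  rewrite -bin2_sum.
  by apply: eq_big_nat => j /andP[_ jm]; rewrite ifT //; lia.
apply: eq_bigr => j _; rewrite ifF; last by lia.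
by congr prev_gap; lia.
Qed.

(** Both sums are sums of binomials. Position [m] in [rot 1 I] is position [i_1 + m] in the cyclic
    [I], so the difference depends on how the stretch between the two cuts meets the parts. *)
Lemma sum_gap_Delta I m : all (leq 1) I -> 0 < m < sumn I ->
  \sum_(0 <= j < m) next_gap I j.+1 =
  \sum_(0 <= j < m) prev_gap (rot 1 I) j + Delta I m.
Proof.
case: I => [|i1 J] I0 mI; first by move: mI => /=; lia.
rewrite /Delta; case locp: (locate (i1 :: J) m) => [p s].
have rotE : rot 1 (i1 :: J) = rcons J i1 by rewrite rot1_cons.
case locq: (locate _ m) => [q t].
have mI1 : 0 < m <= sumn (i1 :: J) by lia.
have mL : 0 < m <= sumn (rot 1 (i1 :: J)).
  by rewrite rotE sumn_rcons; move: mI => /=; lia.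
have L0 : all (leq 1) (rot 1 (i1 :: J)).
  by rewrite rotE all_rcons; case/andP: I0 => ->.
have := sum_next_gap mI1 locp; rewrite (sum_prev_gap mL locq).
move: locp locq => /(locateP _ _ I0 mI1)[pz mp sp] /(locateP _ _ L0 mL)[qz mq tq].
move: pz mp sp qz mq tq; rewrite rotE size_rcons.
case: p q => [|p] [|q] //=; rewrite !ltnS => pz mp /andP[s0 sp] qz mq /andP[t0 tq].
set y := nth 0 (i1 :: J) p in sp *.
have takeS I k : k < size I -> take k.+1 I = take k I ++ [:: nth 0 I k].
  by move=> kI; rewrite (take_nth 0) // cats1.
have takeL : take q (rcons J i1) = take q J by rewrite -cats1 takel_cat.
rewrite takeL in mq *; rewrite big_cons => SG.
(* If the cuts lie in different parts, [y - s], the entries of [D] and [t] add up to [i1]; expanding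
   ['C(i1, 2)] over them leaves [e2]. *)
case: (leqP p q) => [le_pq|lt_qp].
  have JD : take q J = take p J ++ drop p (take q J).
    by rewrite -{1}(cat_take_drop p (take q J)) take_takel.
  set D := drop p _ in JD *.
  have sumy : i1 + sumn (take p J) = sumn (take p (i1 :: J)) + y.
    by rewrite -[LHS]/(sumn (take p.+1 (i1 :: J))) takeS // sumn_cat /= addn0.
  have := bin2_sumn ((y - s) :: D ++ [:: t]).
  rewrite /= sumn_cat big_cons big_cat big_seq1 /= addn0.
  have sumD : sumn (take q J) = sumn (take p J) + sumn D by rewrite JD sumn_cat.
  have -> : y - s + (sumn D + t) = i1 by lia.
  rewrite JD big_cat /= ifF; last by lia.
  by lia.
(* Otherwise both cuts lie in the part [y], at [s] and at [t = i1 + s]. *)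
case: p => // p in mp pz y sp SG lt_qp *; rewrite /= in mp sp *.
have Jp : p < size J by lia.
rewrite nth_rcons ifT in tq; last by lia.
have {lt_qp} pq : p = q.
  apply/eqP; rewrite eqn_leq -[q <= p]ltnS lt_qp andbT leqNgt; apply/negP => lt_qp'.
  have : sumn (take q.+1 J) <= sumn (take p J).
    by rewrite -(cat_take_drop q.+1 (take p J)) take_takel // sumn_cat leq_addr.
  by rewrite takeS ?sumn_cat /=; lia.
subst p; rewrite takeS // big_cat big_seq1 /= -[nth 0 J q]/y in SG.
have tE : t = i1 + s by lia.
rewrite -[nth 0 J q]/y in tq; rewrite ifT; last by lia.
have := bin2D i1 s; have := bin2D (y - s - i1) (i1 + s); have := bin2D (y - s - i1) i1.
have -> : y - s - i1 + (i1 + s) = y by lia.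
have -> : y - s - i1 + i1 = y - s by lia.
rewrite tE mulnDr; nia.
Qed.



End DeltaGaps.

(** * Theta functions as gaps *)

Section ThetaGaps.
Implicit Types (I L : seq nat) (i k : nat).

Lemma sigma_plus_gap I k : (0 < k <= sumn I)%N ->
  sigma_plus I (k%:R : int) = (k + next_gap I k)%N.
Proof.
rewrite /sigma_plus; under eq_bigl do rewrite ler_nat.
rewrite -(big_mkord (fun j => k <= sumn (take j I))%N (fun j => sumn (take j I))).
elim: I k => [|i I IH] k kI; first by move: kI => /=; lia.
rewrite big_ltn_cond //= leqNgt; case/andP: (kI) => -> _ /=.
(* The default of the minimum for [i :: I] is [i] plus that for [I], so [i] factors out. *)
rewrite big_add1 /= -(big_morph (addn i) (addn_minr i) (erefl (i + sumn I)%N)).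
case: (leqP k i) => [le_ki|lt_ik].
  rewrite subnKC // big_ltn_cond //= take0 addn0 le_ki.
  by rewrite min0n addn0.
under eq_bigl => j do rewrite -leq_subLR.
by rewrite IH; move: kI => /=; lia.
Qed.

Lemma sigma_minus_gap L k :
  (sigma_minus L (k%:R : int) + prev_gap L k)%N = k.
Proof.
rewrite /sigma_minus; under eq_bigl do rewrite ler_nat.
elim: L k => [|i L IH] k /=.
  by rewrite big1 // => j _; case: j => -[].
rewrite big_mkcond big_ord_recl /= max0n -big_mkcond /=.
case: (ltnP k i) => [lt_ki|le_ik].
  by rewrite big_pred0 // => j; lia.
rewrite -[RHS](subnKC le_ik) -[in RHS](IH (k - i)%N) addnA; congr (_ + _)%N.
set P := fun j : 'I_(size L).+1 => (sumn (take j L) <= k - i)%N.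
rewrite (eq_bigl P) => [|j]; last by rewrite /P add0n leq_subRL.
(* The default 0 of the maximum does not shift by [i], hence two inequalities; the second uses an
   index attaining the maximum, which exists because the empty prefix qualifies. *)
apply/eqP; rewrite eqn_leq; apply/andP; split.
  apply/bigmax_leqP => j Pj; rewrite add0n leq_add2l.
  exact: (@leq_bigmax_cond _ P (fun j : 'I_(size L).+1 => sumn (take j L)) j Pj).
have P0 : P ord0 by rewrite /P take0.
have P_gt0 : (0 < #|P|)%N by apply/card_gt0P; exists ord0.
have [j Pj ->] := eq_bigmax_cond (fun j : 'I_(size L).+1 => sumn (take j L)) P_gt0.
exact: (@leq_bigmax_cond _ P (fun j : 'I_(size L).+1 => i + sumn (take j L))%N j Pj).
Qed.

End ThetaGaps.

(** * Folding theta graphs and collecting coefficients *)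

Section ThetaCompositions.
Variables (R : comNzRingType) (K : finType) (x : K -> R).
Implicit Types (a b c k m n : nat) (I : seq nat).

Lemma eq_comp_sum n f g :
  (forall I, all (leq 1) I -> sumn I = n -> f I = g I) ->
  comp_sum x n f = comp_sum x n g.
Proof.
move=> fg; apply: eq_big_seq => I; rewrite mem_comps => /andP[I0 /eqP SI].
by rewrite fg.
Qed.

Lemma comp_sumD n f g :
  comp_sum x n (fun I => f I + g I)%N = comp_sum x n f + comp_sum x n g.
Proof.
by rewrite -big_split; apply: eq_bigr => I _ /=; rewrite mulnDl natrD mulrDl.
Qed.

Lemma comp_sum_nat n m (f : nat -> seq nat -> nat) :
  comp_sum x n (fun I => \sum_(0 <= k < m) f k I)%N =
  \sum_(0 <= k < m) comp_sum x n (f k).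
Proof.
rewrite exchange_big; apply: eq_bigr => I _.
by rewrite big_distrl natr_sum mulr_suml.
Qed.

(** [rev (rot 1 I)] keeps the first part and reverses the others: an involution preserving
    [w_I e_I]. *)
Lemma comp_sum_rev_behead n f :
  comp_sum x n (fun I => f (rev (rot 1 I))) = comp_sum x n f.
Proof.
pose h (I : seq nat) := rev (rot 1 I).
have h_cons i J : h (i :: J) = i :: rev J by rewrite /h rot1_cons rev_rcons.
have hK : involutive h by case=> // i J; rewrite !h_cons revK.
have w_h I : w_comp (h I) = w_comp I.
  by case: I => // i J; rewrite h_cons /w_comp /= (perm_big J) // perm_rev.
have e_h I : esp_comp x (h I) = esp_comp x I.
  by case: I => // i J; rewrite h_cons /esp_comp !big_cons (perm_big J) // perm_rev.
have permh : perm_eq (comps n) (map h (comps n)).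
  apply: uniq_perm; first exact: fset_uniq.
    by rewrite map_inj_uniq ?fset_uniq //; apply: inv_inj.
  have h_in I : I \in comps n -> h I \in comps n.
    case: I => // i J; rewrite h_cons !mem_comps /= all_rev.
    by rewrite sumn_rev.
  move=> I; apply/idP/mapP => [In|[J Jn ->]]; last exact: h_in.
  by exists (h I); rewrite ?hK ?h_in.
rewrite /comp_sum [RHS](perm_big _ permh) big_map.
by apply: eq_bigr => I _; rewrite w_h e_h.
Qed.

(** For [0 < k < n] this is the tadpole with [n] vertices, [k - 1] of them on the tail. *)
Let gap_sum n k := comp_sum x n (next_gap^~ k).

Lemma gap_sum_full n : (0 < n)%N -> gap_sum n n = 0.
Proof.
move=> n0; rewrite /gap_sum -[RHS](big1_eq (op := +%R) (comps n) xpredT).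
apply: eq_big_seq => I.
rewrite mem_comps => /andP[_ /eqP SI].
rewrite -[I in next_gap I]cats0 -SI next_gap_cat0 ?mul0r //.
by apply: contraTneq n0 => IE; rewrite -SI IE.
Qed.

(** [theta_step] read backwards moves one edge from the third path to the second; each move leaves
    two tadpoles. *)
Lemma theta_fold a b c :
  theta x a b c = theta x a (b + c) 0 +
    \sum_(0 <= k < c) (gap_sum (a + b + c).+2 k.+2 -
                       gap_sum (a + b + c).+2 (b + k).+2).
Proof.
elim: c b => [|c IH] b; first by rewrite big_nil addr0 addn0.
have := theta_step x a b c; rewrite IH !tadpole_comp_sum => H.
have {H}-> : theta x a b c.+1 = theta x a (b.+1 + c) 0 +
    \sum_(0 <= k < c) (gap_sum (a + b.+1 + c).+2 k.+2 -
                       gap_sum (a + b.+1 + c).+2 (b.+1 + k).+2) +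
    gap_sum (a + b + c.+1).+2 c.+2 - gap_sum (a + c + b.+1).+2 b.+2.
  by rewrite H /gap_sum; ring.
have -> : (a + b.+1 + c = a + b + c.+1)%N by lia.
have -> : (a + c + b.+1 = a + b + c.+1)%N by lia.
rewrite addSnnS -!addrA; congr (_ + _).
(* The new positive tadpole is the last term of its sum, the new negative one the first. *)
rewrite !sumrB big_nat_recr // [X in _ = _ - X]big_nat_recl //= addn0.
have -> : \sum_(0 <= k < c) gap_sum (a + b + c.+1).+2 (b + k.+1).+2 =
    \sum_(0 <= k < c) gap_sum (a + b + c.+1).+2 (b.+1 + k).+2.
  by apply: eq_bigr => k _; rewrite (addnS b).
ring.
Qed.

(** Fold with the chord as the fixed path. The final cycle is the gap sum at 1, and reversal turns
    the subtracted gaps into those of [prev_gap (rot 1 I)], as in [sum_gap_Delta]. *)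
Lemma theta_chord a m :
  theta x a m 0 = comp_sum x (a + m).+2 (Delta^~ m.+1).
Proof.
set n := (a + m).+2; apply: (@addrI _ (\sum_(0 <= j < m.+1) gap_sum n (n - j))).
have -> : theta x a m 0 = \sum_(0 <= j < m.+1) gap_sum n j.+1 -
    \sum_(0 <= k < m) gap_sum n (a + k).+2.
  rewrite theta_rot theta_fold theta0n0 tadpole_comp_sum add0n addn0 -/n.
  by rewrite sumrB addrA big_nat_recl.
have -> : \sum_(0 <= k < m) gap_sum n (a + k).+2 =
    \sum_(0 <= j < m.+1) gap_sum n (n - j).
  (* The extra term [j = 0] is the gap at [n], which vanishes. *)
  rewrite [RHS]big_nat_rev [RHS]big_nat_recr //= add0n subnn subn0 gap_sum_full // addr0.
  by apply: eq_big_nat => k /andP[_ km]; congr gap_sum; rewrite /n; lia.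
rewrite [LHS]addrC subrK /gap_sum -!comp_sum_nat.
rewrite -(comp_sum_rev_behead n
  (fun I => \sum_(0 <= j < m.+1) next_gap I (n - j)))%N.
rewrite -comp_sumD; apply: eq_comp_sum => I I0 SI.
rewrite sum_gap_Delta // ?SI /n; last by lia.
congr (_ + _)%N; apply: eq_big_nat => j /andP[_ jm].
have S1 : sumn (rot 1 I) = n.
  by rewrite -SI !sumnE; apply: perm_big; rewrite perm_rot.
by rewrite prev_gapE S1 // /n; lia.
Qed.

Lemma theta_comp_sum a b c :
  theta x a b c = \sum_(I <- comps (a + b + c).+2)
    (c_comp a.+1 b.+1 c.+1 I * (w_comp I)%:R)%:~R * esp_comp x I.
Proof.
set n := (a + b + c).+2.
rewrite theta_fold theta_chord addnA -/n.
have -> : (b + c).+1 = (b.+1 + c.+1 - 1)%N by lia.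
rewrite sumrB /gap_sum -!comp_sum_nat -sumrB -big_split.
apply: eq_big_seq => I /=; rewrite mem_comps => /andP[_ /eqP SI].
have toZ k : k%:R = (k%:R : int)%:~R :> R by rewrite rmorph_nat.
rewrite -mulrBl -mulrDl !toZ; congr (_ * _).
rewrite -!(rmorphB, rmorphD) !natrM -mulrBl -mulrDl /c_comp; congr (_ * _)%:~R.
rewrite [RHS]addrC; congr (_ + _); congr (_ - _).
  rewrite big_add1 /= big_add1 /= natr_sum; apply: eq_big_nat => k /andP[_ kc].
  rewrite /Theta_plus sigma_plus_gap; last by rewrite SI /n; lia.
  by rewrite natrD addrC addKr.
have -> : (a.+1 + c.+1 - 1 = c + a.+1)%N by lia.
(* The backward gap of [rev I] at [j] is the forward gap of [I] at [n - j], so the order of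
   summation is reversed. *)
rewrite -[X in _ = \sum_(X <= _ < _) _](add0n a.+1) big_addn addnK big_nat_rev natr_sum add0n.
apply: eq_big_nat => k /andP[_ kc]; rewrite /Theta_minus.
set j := (k + a.+1)%N.
rewrite -{1}(sigma_minus_gap (rev I) j) natrD addrC addKr.
rewrite prev_gapE sumn_rev SI ?revK; last by rewrite /n /j; lia.
by congr (next_gap _ _)%:R; rewrite /n /j; lia.
Qed.

End ThetaCompositions.

(** * Walks as colourings of paths *)

Lemma prodr_forall (R : comNzRingType) (T : finType) (P : pred T) :
  \prod_t (P t)%:R = ([forall t, P t])%:R :> R.
Proof.
case: (boolP [forall t, P t]) => [/forallP allP|].
  by rewrite big1 // => t _; rewrite allP.
by case/forallPn => t nPt; rewrite (bigD1 t) //= (negPf nPt) mul0r.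
Qed.

Definition proper_coloring (V K : finType) (e : rel V) (kappa : {ffun V -> K}) :=
  [forall p, forall q, e p q ==> (kappa p != kappa q)].

Section WalkColorings.
Variables (R : comNzRingType) (K : finType) (x : K -> R).
Implicit Types (u v q : K) (n j : nat).

(* The colour at distance [j] from the start of a path of length [n.+1] with
   ends coloured [u] and [v] and inner vertices coloured by [g]. *)
Definition walk_color n (g : {ffun 'I_n -> K}) u v j : K :=
  if j is j'.+1 then if (insub j' : option 'I_n) is Some i then g i else v
  else u.

Definition walk_weight n (g : {ffun 'I_n -> K}) u v : R :=
  \prod_i x (g i) *
  \prod_(j < n.+1) neqr R (walk_color g u v j) (walk_color g u v j.+1).

(** [cons_ff] splits off the first inner colour, from which the remaining walk starts, matching
    [walkS]. *)
Lemma walk_colorings n u v :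
  walk x n u v = \sum_(g : {ffun 'I_n -> K}) walk_weight g u v.
Proof.
elim: n u => [|n IH] u.
  have g0 : {ffun 'I_0 -> K} by apply: finfun; case.
  rewrite walk0 (big_pred1 g0) => [|g]; last first.
    by rewrite /=; apply/esym/eqP/ffunP; case.
  rewrite /walk_weight big_ord0 mul1r big_ord_recl big_ord0 mulr1.
  by rewrite /walk_color insubF.
pose cons_ff (qg : K * {ffun 'I_n -> K}) : {ffun 'I_n.+1 -> K} :=
  [ffun i => if unlift ord0 i is Some j then qg.2 j else qg.1].
have cons0 q g : cons_ff (q, g) ord0 = q by rewrite ffunE unlift_none.
have consS q g i : cons_ff (q, g) (lift ord0 i) = g i by rewrite ffunE liftK.
have cons_bij : bijective cons_ff.
  exists (fun g : {ffun 'I_n.+1 -> K} =>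
    (g ord0, [ffun i : 'I_n => g (lift ord0 i)])).
    move=> [q g]; rewrite cons0; congr (_, _); apply/ffunP => i.
    by rewrite ffunE consS.
  move=> g; apply/ffunP => i; rewrite ffunE.
  by case: unliftP => [j|] -> //=; rewrite ffunE.
rewrite walkS (reindex cons_ff) /=; last exact: onW_bij.
rewrite -(pair_bigA _ (fun q g => walk_weight (cons_ff (q, g)) u v)) /=.
apply: eq_bigr => q _; rewrite IH !mulr_sumr; apply: eq_bigr => g _.
rewrite /walk_weight [\prod_(i < n.+1) x _]big_ord_recl cons0.
rewrite [\prod_(j < n.+2) _]big_ord_recl.
under [\prod_(i < n) x (cons_ff _ _)]eq_bigr do rewrite consS.
have colS j : walk_color (cons_ff (q, g)) u v j.+1 = walk_color g q v j.
  case: j => [|j] /=.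
    case: insubP => // i _ i0; rewrite -[RHS](cons0 q g); congr (cons_ff _ _).
    exact: val_inj.
  case: insubP => [i|]; rewrite ltnS => lt_jn.
    move=> ij; rewrite insubT -(consS q); congr (cons_ff _ _).
    exact: val_inj.
  by rewrite insubN.
rewrite colS -[walk_color _ u v 0]/u -[walk_color _ q v 0]/q.
under [X in _ = _ * (_ * X)]eq_bigr => j _ do rewrite lift0 !colS.
ring.
Qed.

End WalkColorings.

(** * Colourings of the theta graph *)

Section ThetaColorings.
Variables (R : comNzRingType) (K : finType) (x : K -> R) (a b c : nat).

Let V := theta_vertex a.+1 b.+1 c.+1.

Let proper := proper_coloring (K := K) (@theta_edge a.+1 b.+1 c.+1).

Let ord3 m (lt_m3 : (m < 3)%N) : 'I_3 := Ordinal lt_m3.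

(** Matching on the number inside [k] makes the dependent domain reduce to ['I_a], ['I_b] or ['I_c];
    [u] is the default colour out of range. *)
Definition glue (u : K) (ga : {ffun 'I_a -> K}) (gb : {ffun 'I_b -> K})
    (gc : {ffun 'I_c -> K}) (k : 'I_3) :
    'I_(theta_len a.+1 b.+1 c.+1 k).-1 -> K :=
  let: Ordinal m lt_m3 := k in
  match m return forall lt_m3 : (m < 3)%N,
    'I_(theta_len a.+1 b.+1 c.+1 (Ordinal lt_m3)).-1 -> K with
  | 0 => fun _ => ga
  | 1 => fun _ => gb
  | 2 => fun _ => gc
  | _ => fun _ _ => u
  end lt_m3.


Definition glue_color (uv : K * K)
    (g : {ffun 'I_a -> K} * {ffun 'I_b -> K} * {ffun 'I_c -> K}) : {ffun V -> K} :=
  [ffun p : V => match p with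
   | inl end2 => if end2 then uv.2 else uv.1
   | inr s => glue uv.1 g.1.1 g.1.2 g.2 (tagged s)
   end].

Lemma glue_color_bij : bijective (fun z => glue_color z.1 z.2).
Proof.
exists (fun kappa : {ffun V -> K} =>
  ((kappa (inl false), kappa (inl true)),
   ([ffun i : 'I_a => kappa (inr (existT _ (@ord3 0 isT) i))],
    [ffun i : 'I_b => kappa (inr (existT _ (@ord3 1 isT) i))],
    [ffun i : 'I_c => kappa (inr (existT _ (@ord3 2 isT) i))]))).
  move=> [[u v] [[ga gb] gc]] /=; rewrite !ffunE /=.
  by congr (_, (_, _, _)); apply/ffunP => i; rewrite !ffunE.
move=> kappa; apply/ffunP => -[[]|[[m lt_m3] i]]; rewrite ffunE //=.
case: m lt_m3 i => [|[|[|//]]] lt_m3 i /=; rewrite ffunE; congr (kappa (inr _));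
  by rewrite (bool_irrelevance lt_m3 isT).
Qed.

Lemma proper_theta (kappa : {ffun V -> K}) :
  proper kappa =
  [forall k : 'I_3, forall j : 'I_(theta_len a.+1 b.+1 c.+1 k),
    kappa (theta_pos a.+1 b.+1 c.+1 k j) != kappa (theta_pos a.+1 b.+1 c.+1 k j.+1)].
Proof.
apply/forallP/forallP => [H k|H p].
  apply/forallP => j.
  have /forallP/(_ (theta_pos a.+1 b.+1 c.+1 k j.+1)) :=
    H (theta_pos a.+1 b.+1 c.+1 k j).
  by move/implyP; apply; apply/existsP; exists k; apply/existsP; exists j; rewrite !eqxx.
apply/forallP => q; apply/implyP => /existsP[k /existsP[j]].
have /forallP/(_ j) := H k.
by move=> neq /orP[] /andP[/eqP-> /eqP->] //; rewrite eq_sym.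
Qed.

Lemma prod_ord3 (F : 'I_3 -> R) :
  \prod_k F k = F (@ord3 0 isT) * F (@ord3 1 isT) * F (@ord3 2 isT).
Proof.
rewrite !big_ord_recl big_ord0 mulr1 mulrA.
by congr (F _ * F _ * F _); apply: val_inj.
Qed.

(** Apart from the two ends, vertices and edges split over the three paths; properness becomes a
    product of [neqr] over the edges. *)
Lemma glue_weight uv g :
  (if proper (glue_color uv g) then \prod_p x (glue_color uv g p) else 0) =
  x uv.1 * x uv.2 * walk_weight x g.1.1 uv.1 uv.2 *
    walk_weight x g.1.2 uv.1 uv.2 * walk_weight x g.2 uv.1 uv.2.
Proof.
set kappa := glue_color uv g.
have -> (y : R) : (if proper kappa then y else 0) = y * (proper kappa)%:R.
  by case: (proper kappa); rewrite ?mulr1 ?mulr0.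
rewrite proper_theta -prodr_forall.
under [X in _ * X]eq_bigr do rewrite -prodr_forall.
pose inner (k : 'I_3) (i : 'I_(theta_len a.+1 b.+1 c.+1 k).-1) : V :=
  inr (existT _ k i).
have -> : \prod_p x (kappa p) = x uv.1 * x uv.2 *
    \prod_(k < 3) \prod_(i < (theta_len a.+1 b.+1 c.+1 k).-1) x (kappa (inner k i)).
  rewrite big_sumType /= big_bool /= mulrC [x _ * x _]mulrC.
  rewrite !ffunE /= mulrC; congr (_ * _).
  rewrite (sig_big_dep _ _ (fun k i => x (kappa (inner k i)))) /=.
  by apply: eq_bigr => -[].
rewrite -mulrA -big_split prod_ord3 mulrA [X in X * _]mulrA.
have col0 j : kappa (theta_pos a.+1 b.+1 c.+1 (@ord3 0 isT) j) =
    walk_color g.1.1 uv.1 uv.2 j.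
  by case: j => [|j]; rewrite ffunE //=; case: insub.
have col1 j : kappa (theta_pos a.+1 b.+1 c.+1 (@ord3 1 isT) j) =
    walk_color g.1.2 uv.1 uv.2 j.
  by case: j => [|j]; rewrite ffunE //=; case: insub.
have col2 j : kappa (theta_pos a.+1 b.+1 c.+1 (@ord3 2 isT) j) =
    walk_color g.2 uv.1 uv.2 j.
  by case: j => [|j]; rewrite ffunE //=; case: insub.
rewrite /walk_weight.
congr (_ * (_ * _) * (_ * _) * (_ * _)); apply: eq_bigr => i _;
  by rewrite ?(col0, col1, col2) // ffunE.
Qed.

Lemma theta_colorings :
  theta x a b c =
  \sum_(kappa : {ffun V -> K} | proper_coloring (@theta_edge a.+1 b.+1 c.+1) kappa)
    \prod_p x (kappa p).
Proof.
rewrite big_mkcond (reindex _ (onW_bij _ glue_color_bij)) /=.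
under [RHS]eq_bigr do rewrite glue_weight.
pose F uv g := x uv.1 * x uv.2 *
  walk_weight x (g : {ffun 'I_a -> K} * {ffun 'I_b -> K} * {ffun 'I_c -> K}).1.1 uv.1 uv.2 *
  walk_weight x g.1.2 uv.1 uv.2 * walk_weight x g.2 uv.1 uv.2.
rewrite -(pair_bigA _ F) /theta [LHS]pair_bigA /=; apply: eq_bigr => -[u v] _ /=.
rewrite !walk_colorings -(pair_bigA _ (fun gab gc => F (u, v) (gab, gc))) /=.
rewrite -(pair_bigA _ (fun ga gb => \sum_gc F (u, v) (ga, gb, gc))) /=.
rewrite [X in X * _ * _]mulr_sumr !mulr_suml; apply: eq_bigr => ga _.
rewrite [X in X * _]mulr_sumr mulr_suml; apply: eq_bigr => gb _.
by rewrite mulr_sumr.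
Qed.

End ThetaColorings.

(** * Restriction to finitely many variables *)

Section Truncation.
Variables (R : comNzRingType) (N : nat).
Implicit Types (f g : mseries R) (m : monomial).

Definition bounded_mono m := forall i, i \in m -> (i < N)%N.

Definition agree f g := forall m, bounded_mono m -> f m = g m.

(** Divisors of a bounded monomial are bounded. *)
Lemma agree_mul f1 f2 g1 g2 :
  agree f1 f2 -> agree g1 g2 -> agree (f1 * g1) (f2 * g2).
Proof.
move=> f12 g12 m mN; apply: eq_big_seq => d; rewrite mem_mdivisors => le_dm.
have sub_bd e : (e `<=` m)%mset -> bounded_mono e.
  by move=> le_em i ie; apply: mN; apply: (msubset_subset le_em).
by rewrite f12 ?g12 //; apply: sub_bd => //; exact: msubsetDl.
Qed.

Lemma agree_prod (T : Type) (s : seq T) (F G : T -> mseries R) :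
  (forall t, agree (F t) (G t)) -> agree (\prod_(t <- s) F t) (\prod_(t <- s) G t).
Proof.
move=> FG; elim: s => [|t s IH]; first by rewrite !big_nil.
by rewrite !big_cons; apply: agree_mul.
Qed.

Lemma mcoef_sum (T : Type) (s : seq T) (P : pred T) (F : T -> mseries R) m :
  (\sum_(t <- s | P t) F t) m = \sum_(t <- s | P t) F t m.
Proof. by rewrite (big_morph (fun f => f m) (id1 := 0) (op1 := +%R)). Qed.

Definition var (i : 'I_N) : mseries R := ms_var R i.

Lemma agree_elem_sym k : agree (elem_sym R k) (esp var k).
Proof.
move=> m mN; rewrite elem_symE mcoef_sum.
(* The only set whose product can be [m] is the support of [m]. *)
pose S0 := [set i : 'I_N | val i \in m].
have S0P (S : {set 'I_N}) :
    (\prod_(i in S) var i) m = (uniq (enum_mset m) && (S == S0))%:R.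
  rewrite /var -big_enum -(big_map val predT) prod_ms_var; congr ((nat_of_bool _)%:R : R).
  have uS : uniq [seq val i | i <- enum S] by rewrite (map_inj_uniq val_inj) enum_uniq.
  have memS (i : 'I_N) : (val i \in [seq val i | i <- enum S]) = (i \in S).
    by rewrite (mem_map val_inj) mem_enum.
  apply/eqP/andP => [mE|[um /eqP SE]].
    have pm : perm_eq (enum_mset m) [seq val i | i <- enum S].
      by rewrite mE perm_eq_seq_mset.
    split; first by rewrite (perm_uniq pm).
    apply/eqP/setP => i.
    by rewrite inE -[val i \in m]/(val i \in enum_mset m) (perm_mem pm) memS.
  rewrite -[LHS]seq_mset_id; apply/eq_seq_msetP; apply: uniq_perm => // i.
  apply/idP/idP => [im|/mapP[j jS ->]].
    by rewrite -[i]/(val (Ordinal (mN i im))) memS SE inE.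
  by move: jS; rewrite mem_enum SE inE.
under eq_bigr do rewrite S0P.
case: (boolP (uniq _)) => um /=; last by rewrite andbF big1.
rewrite andbT.
have -> : size (enum_mset m) = #|S0|.
  have := S0P S0; rewrite um eqxx /var -big_enum -(big_map val predT) prod_ms_var.
  case: eqP => [mE _|_ /eqP]; last by rewrite eq_sym oner_eq0.
  by rewrite mE (perm_size (perm_eq_seq_mset _)) size_map cardE.
case: eqP => [cS|nS].
  rewrite (bigD1 S0) ?cS //= eqxx big1 ?addr0 // => S /andP[_ /negPf->] //.
by rewrite big1 // => S /eqP cS; case: eqP => // SE; case: nS; rewrite -SE.
Qed.

Lemma mcoef_chromatic (V : finType) (e : rel V) m : bounded_mono m ->
  chromatic_sym R e m =
  (\sum_(kappa : {ffun V -> 'I_N} | proper_coloring e kappa)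
    \prod_v var (kappa v)) m.
Proof.
move=> mN; rewrite mcoef_sum.
pose emb (k : {ffun V -> 'I_N}) : {ffun V -> nat} := [ffun v => val (k v)].
have emb_inj : injective emb.
  move=> k k' /ffunP E; apply/ffunP => v; have := E v; rewrite !ffunE; exact: val_inj.
pose B := @proper_coloring V 'I_N e.
pose s := [seq k <- enum {: {ffun V -> 'I_N}} | B k].
have s_uniq : uniq s by exact: filter_uniq (enum_uniq _).
change (\sum_(k \in [set k : {ffun V -> nat} | forall p q, e p q -> k p <> k q])
  (\prod_v ms_var R (k v)) m = \sum_(k | B k) (\prod_v var (k v)) m).
rewrite -(fsbig_widen (emb @` [set` s])) /=.
- rewrite fsbig_image; last by move=> k k' _ _; apply: emb_inj.
  rewrite -(fsbig_seq _ (fun k => (\prod_v ms_var R (emb k v)) m) s_uniq).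
  rewrite big_filter big_enum_cond; apply: eq_bigr => k _.
  apply: (congr1 (fun f : mseries R => mcoef f m)).
  by apply: eq_bigr => v _; rewrite ffunE.
- move=> _ [k /= kB <-] p q epq; rewrite !ffunE => /val_inj.
  move: kB; rewrite mem_filter.
  by move=> /andP[/forallP/(_ p)/forallP/(_ q)/implyP/(_ epq)/eqP].
(* A colouring contributing to [m] uses only colours in [m], all below [N], so it comes from
   [emb]. *)
move=> k [/= k_proper k_emb].
have -> : \prod_v ms_var R (k v) = \prod_(i <- [seq k v | v : V]) ms_var R i.
  by rewrite big_map big_enum.
rewrite prod_ms_var; case: eqP => // mE; case: k_emb.
have kN v : (k v < N)%N.
  apply: mN; rewrite -[_ \in m]/(_ \in enum_mset m) mE.
  by rewrite (perm_mem (perm_eq_seq_mset _)); apply/mapP; exists v; rewrite ?mem_enum.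
exists [ffun v => Ordinal (kN v)]; last by apply/ffunP => v; rewrite !ffunE.
rewrite mem_filter mem_enum andbT; apply/forallP => p; apply/forallP => q.
apply/implyP => epq; rewrite !ffunE; apply/eqP => -[]; exact: k_proper.
Qed.

End Truncation.

Theorem theorem3p1 (a b c n : nat) (hab : (b <= a)%N) (hbc : (c <= b)%N)
    (hc : (1 <= c)%N) (hb : (2 <= b)%N) (hn : n = (a + b + c - 1)%N) :
  chromatic_sym int (@theta_edge a b c) =
  \sum_(I \in [set I | composition n I])
     (c_comp a b c I * (w_comp I)%:R)%:~R * e_comp int I.
Proof.
case: a b c hab hbc hc hb hn => [|a] [|b] [|c] // _ _ _ _ hn.
have {hn} -> : n = (a + b + c).+2 by lia.
rewrite fsbig_finite; last exact: finite_composition.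
(* [N] exceeds every variable of [m], so this coefficient can be computed with [N] colours. *)
apply/mseriesP => m; pose N := (\max_(i <- enum_mset m) i).+1.
have mN : bounded_mono N m.
  by move=> i im; rewrite ltnS; apply: (@leq_bigmax_seq _ _ xpredT id).
rewrite (mcoef_chromatic _ _ mN) -theta_colorings theta_comp_sum !mcoef_sum.
apply: eq_bigr => I _; apply: (@agree_mul _ N) => //.
move=> d dN; apply/esym; apply: agree_prod dN => i; exact: agree_elem_sym.
Qed.
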